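(* Let $d\ge1$ and let $f:\mathbb{R}^d\to\mathbb{R}$ be additive, i.e. $f(x+y)=f(x)+f(y)$ for all $x,y\in\mathbb{R}^d$, and let $G(f)=\{(x,f(x)):x\in\mathbb{R}^d\}\subseteq\mathbb{R}^{d+1}$. (a) There exists $s\in\{0,1,\dots,d+1\}$ and an $s$-dimensional vector subspace $V\subseteq\mathbb{R}^{d+1}$ such that the connected component $G$ of $G(f)$ containing the origin is a subgroup of $V$ which is dense in $V$. Moreover, every connected component of $G(f)$ is of the form $\tau+G$ for some $\tau\in\mathbb{R}^{d+1}$. (b) For every $s\in\{0,1,\dots,d+1\}$ there exists an additive function $f:\mathbb{R}^d\to\mathbb{R}$ for which the number $s$ in (a) takes this value.
   Context: $\mathbb{R}^{d+1}$ carries the Euclidean topology and $G(f)$ the subspace topology; connected components are taken in $G(f)$. *)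

(* Defs.v *)
From Stdlib Require Import Reals.
From mathcomp Require Import all_boot.
Set Implicit Arguments. Unset Strict Implicit. Unset Printing Implicit Defensive.
Open Scope R_scope.

Definition Rn (n : nat) := 'I_n -> R.

Definition vzero {n} : Rn n := fun _ => 0.
Definition vadd {n} (x y : Rn n) : Rn n := fun i => x i + y i.
Definition vopp {n} (x : Rn n) : Rn n := fun i => - x i.
Definition vsub {n} (x y : Rn n) : Rn n := fun i => x i - y i.
Definition vscale {n} (c : R) (x : Rn n) : Rn n := fun i => c * x i.

Definition dist {n} (x y : Rn n) : R :=
  sqrt (\big[Rplus/0]_(i < n) ((x i - y i) ^ 2)).

Definition is_open {n} (U : Rn n -> Prop) : Prop :=
  forall x, U x -> exists eps, 0 < eps /\ forall y, dist x y < eps -> U y.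

Definition connected {n} (S : Rn n -> Prop) : Prop :=
  forall U1 U2 : Rn n -> Prop, is_open U1 -> is_open U2 ->
    (forall x, S x -> U1 x \/ U2 x) ->
    (forall x, S x -> U1 x -> U2 x -> False) ->
    (forall x, S x -> U1 x) \/ (forall x, S x -> U2 x).

Definition component {n} (X : Rn n -> Prop) (p : Rn n) : Rn n -> Prop :=
  fun q => exists C : Rn n -> Prop,
    (forall z, C z -> X z) /\ connected C /\ C p /\ C q.

Definition additive {d} (f : Rn d -> R) : Prop :=
  forall x y, f (vadd x y) = f x + f y.

Definition graph {d} (f : Rn d -> R) : Rn d.+1 -> Prop :=
  fun q => q ord_max = f (fun i : 'I_d => q (widen_ord (leqnSn d) i)).

Definition is_subspace {n} (V : Rn n -> Prop) : Prop :=
  V vzero /\ (forall x y, V x -> V y -> V (vadd x y)) /\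
  (forall c x, V x -> V (vscale c x)).

Definition lincomb {n s} (c : 'I_s -> R) (b : 'I_s -> Rn n) : Rn n :=
  fun j => \big[Rplus/0]_(i < s) (c i * b i j).

Definition has_dim {n} (V : Rn n -> Prop) (s : nat) : Prop :=
  exists b : 'I_s -> Rn n,
    (forall c, lincomb c b = vzero -> forall i, c i = 0) /\
    (forall v, V v <-> exists c, v = lincomb c b).

Definition is_subgroup {n} (G : Rn n -> Prop) : Prop :=
  G vzero /\ (forall x y, G x -> G y -> G (vadd x y)) /\
  (forall x, G x -> G (vopp x)).

Definition dense_in {n} (G V : Rn n -> Prop) : Prop :=
  forall v, V v -> forall eps, 0 < eps -> exists g, G g /\ dist g v < eps.

Definition dense_subgroup_of {n} (G V : Rn n -> Prop) : Prop :=
  is_subgroup G /\ (forall x, G x -> V x) /\ dense_in G V.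

(* Main.v *)
From Stdlib Require Import Reals.
From mathcomp Require Import all_boot all_order all_algebra.
From mathcomp Require Import all_classical all_reals topology normedtype.
From mathcomp Require Import Rstruct.
From mathcomp Require Import ring lra zify.
Set Implicit Arguments. Unset Strict Implicit. Unset Printing Implicit Defensive.
Import Order.TTheory GRing.Theory Num.Theory numFieldNormedType.Exports.
Require Import Defs.
Open Scope R_scope.

(** (a) Translations by points of the graph preserve the graph, so the component
    G of the origin is a subgroup and the other components are its translates.
    Let V be the largest vector subspace contained in the closure H of G.  Modulo
    V the closed subgroup H is discrete, so V is relatively open in H; as G is
    connected it lies in V, and it is dense in V since V is contained in H.

    (b) The reals z_S, for S a set of naturals, obtained by summing 1/k! over the
    codes k of the finite prefixes of S, are linearly independent over Q.
    For s = d+1, closed sets of the plane are coded by sets of naturals, and an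
    additive g : R -> R with prescribed values at rational multiples of the z_S
    has a graph that meets every closed set whose projection contains an interval.
    This makes the graph dense and connected, and so is that of x |-> g x_0.
    For s <= d, points of R^d are coded too, which gives an additive injection h
    of R^d into R missing the nonzero rational multiples of some real w.
    Composing h with the projection that kills the first s coordinates, the last
    coordinate is constant on the components of the graph, and the component of
    the origin is spanned by the first s coordinate vectors. *)

(** * Linear algebra over the rationals *)

Section RationalSpaces.
Local Open Scope ring_scope.
Local Open Scope classical_set_scope.

Variable R : realType.
Implicit Types (E F : lmodType R).

(** The rational structure of a real vector space is read through [ratr], so that the reals, row
    vectors and products of real spaces can be used as they are. *)
Definition qsubspace E (W : set E) :=
  W 0 /\ forall (q : rat) x y, W x -> W y -> W (ratr q *: x + y).

Definition qlinear E F (k : E -> F) :=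
  forall (q : rat) x y, k (ratr q *: x + y) = ratr q *: k x + k y.

Lemma qsubspaceD E (W : set E) x y : qsubspace W -> W x -> W y -> W (x + y).
Proof. by move=> [_ WL] Wx Wy; rewrite -[x]scale1r -(rmorph1 ratr); apply: WL. Qed.

Lemma qsubspaceZ E (W : set E) (q : rat) x :
  qsubspace W -> W x -> W (ratr q *: x).
Proof. by move=> [W0 WL] Wx; rewrite -[_ *: _]addr0; apply: WL. Qed.

Lemma qsubspaceB E (W : set E) x y : qsubspace W -> W x -> W y -> W (x - y).
Proof.
move=> Wq Wx Wy; apply: qsubspaceD => //.
by rewrite -scaleN1r -(rmorph1 ratr) -rmorphN; apply: qsubspaceZ.
Qed.

Lemma qlinearD E F (k : E -> F) x y : qlinear k -> k (x + y) = k x + k y.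
Proof. by move=> kL; have := kL 1 x y; rewrite !rmorph1 !scale1r. Qed.

Lemma qlinear0 E F (k : E -> F) : qlinear k -> k 0 = 0.
Proof.
by move=> kL; apply: (addIr (k 0)); rewrite -qlinearD // !add0r.
Qed.

Lemma qlinearZ E F (k : E -> F) (q : rat) x :
  qlinear k -> k (ratr q *: x) = ratr q *: k x.
Proof. by move=> kL; rewrite -[in LHS](addr0 (_ *: x)) kL qlinear0 ?addr0. Qed.

(** Zorn's lemma gives [W] maximal among the rational subspaces that contain [W0] and meet [N] only
    in 0; a vector outside [N + W] could be adjoined to it. *)
Lemma qsubspace_complement E (N W0 : set E) :
  qsubspace N -> qsubspace W0 -> (forall x, N x -> W0 x -> x = 0) ->
  exists W, [/\ qsubspace W, W0 `<=` W, forall x, N x -> W x -> x = 0 &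
    forall x, exists n w, [/\ N n, W w & x = n + w]].
Proof.
move=> Nq W0q NW0.
pose good W := qsubspace W /\ forall x, N x -> W x -> x = 0.
(* The condition bears on the union of [A] with [W0], so that the empty chain is covered too: its
   union yields [W0] itself. *)
have [F FP Ftot|A [[Aq AN] Amax]] := @Zorn_bigcup E [set A | good (A `|` W0)].
  split; first split.
  - by right; exact: W0q.1.
  - move=> q x y [[X FX Xx]|W0x] [[Y FY Yy]|W0y].
    + have [XY|YX] := Ftot _ _ FX FY.
      * have [[_ Yq] _] := FP _ FY.
        by have [?|] := Yq q x y (or_introl (XY _ Xx)) (or_introl Yy);
          [left; exists Y|right].
      * have [[_ Xq] _] := FP _ FX.
        by have [?|] := Xq q x y (or_introl Xx) (or_introl (YX _ Yy));
          [left; exists X|right].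
    + have [[_ Xq] _] := FP _ FX.
      by have [?|] := Xq q x y (or_introl Xx) (or_intror W0y);
        [left; exists X|right].
    + have [[_ Yq] _] := FP _ FY.
      by have [?|] := Yq q x y (or_intror W0x) (or_introl Yy);
        [left; exists Y|right].
    + by right; apply: W0q.2.
  - move=> x Nx [[X FX Xx]|W0x]; last exact: NW0.
    by have [_ XN] := FP _ FX; apply: XN => //; left.
pose W := A `|` W0; exists W; split => //; first by move=> x; right.
apply: contrapT => /existsNP[x xNW].
pose B := [set y | exists (q : rat) w, W w /\ y = ratr q *: x + w].
have WB : W `<=` B by move=> w Ww; exists 0, w; rewrite rmorph0 scale0r add0r.
have BW0 : B `|` W0 = B.
  by apply/seteqP; split=> [y [//|W0y]|y By]; [apply: WB; right|left].
have Bx : B x by exists 1, 0; rewrite rmorph1 scale1r addr0; split=> //; exact: Aq.1.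
have xW : ~ W x.
  by move=> Wx; apply: xNW; exists 0, x; rewrite add0r; split=> //; exact: Nq.1.
apply: (Amax B).
  split; first by move=> y Ay; apply: WB; left.
  by move=> BA; apply: xW; left; apply: BA.
rewrite /= BW0; split; first split.
- by apply: WB; exact: Aq.1.
- move=> q _ _ [q1 [w1 [Ww1 ->]]] [q2 [w2 [Ww2 ->]]].
  exists (q * q1 + q2), (ratr q *: w1 + w2); split; first exact: Aq.2.
  by rewrite rmorphD rmorphM scalerDr scalerA scalerDl addrACA.
- move=> y Ny [q [w [Ww yE]]].
  have [q0|q0] := eqVneq q 0.
    by move: Ny; rewrite yE q0 rmorph0 scale0r add0r => Ny; apply: AN.
  (* As [q] is nonzero, solving [y = q x + w] for [x] puts [x] in [N + W]. *)
  case: xNW; exists (ratr q^-1 *: y), (ratr (- q^-1) *: w).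
  split; [exact: qsubspaceZ Ny|exact: qsubspaceZ|].
  rewrite yE scalerDr scalerA -rmorphM mulVf // rmorph1 scale1r.
  by rewrite rmorphN scaleNr addrK.
Qed.

(* A complement of 0 x F containing the span of the pairs (z i, v i) is the
   graph of the required extension. *)
Lemma qlinear_extension E F (I : Type) (z : I -> E) (v : I -> F) :
  (forall l : seq (rat * I), \sum_(p <- l) ratr p.1 *: z p.2 = 0 ->
     \sum_(p <- l) ratr p.1 *: v p.2 = 0) ->
  exists k : E -> F, qlinear k /\ forall i, k (z i) = v i.
Proof.
move=> zv.
pose N := [set p : E * F | p.1 = 0].
pose W0 := [set p : E * F | exists l : seq (rat * I),
  p = (\sum_(p <- l) ratr p.1 *: z p.2, \sum_(p <- l) ratr p.1 *: v p.2)].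
have [||[x y] /=|W [Wq W0W NW NWT]] := @qsubspace_complement (E * F)%type N W0.
- by split=> // q [x x'] [y y']; rewrite /N /= => -> ->; rewrite scaler0 addr0.
- split; first by exists [::]; rewrite !big_nil.
  move=> q _ _ [l ->] [l' ->].
  exists ([seq (q * p.1, p.2) | p <- l] ++ l').
  rewrite !big_cat !big_map /=; congr (_, _) => /=;
    rewrite scaler_sumr; congr (_ + _); apply: eq_bigr => p _ /=;
    by rewrite rmorphM scalerA.
- by rewrite /N /= => -> [l [l0 ->]]; rewrite zv.
have ex x : exists y, W (x, y).
  have [[n1 n2] [[w1 w2] [n10 Ww [-> _]]]] := NWT (x, 0).
  by exists w2; rewrite [n1]n10 add0r.
have uniqW x y y' : W (x, y) -> W (x, y') -> y = y'.
  move=> Wy Wy'; have yy' : N ((x, y) - (x, y')) by rewrite /N /= subrr.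
  have [_ /eqP] := NW _ yy' (qsubspaceB Wq Wy Wy').
  by rewrite subr_eq0 => /eqP.
pose k x := projT1 (cid (ex x)).
have kP x : W (x, k x) by rewrite /k; case: cid.
exists k; split.
  move=> q x y; apply: (uniqW _ _ _ (kP _)).
  exact: (Wq.2 q (x, k x) (y, k y)).
move=> i; apply: (uniqW _ _ _ (kP _)); apply: W0W; exists [:: (1, i)].
by rewrite !big_seq1 /= rmorph1 !scale1r.
Qed.

(** On a complement of its kernel [k] is bijective, and the inverse is additive. *)
Lemma qlinear_section E F (k : E -> F) : qlinear k ->
  (forall y, exists x, k x = y) ->
  exists h : F -> E, {morph h : x y / x + y} /\ cancel h k.
Proof.
move=> kL ksurj.
pose N := [set x | k x = 0].
have Nq : qsubspace N.
  split; first exact: qlinear0.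
  by move=> q x y; rewrite /N /= kL => -> ->; rewrite scaler0 addr0.
have [||W [Wq _ NW NWT]] := @qsubspace_complement _ N [set 0] Nq.
- by split=> // q x y -> ->; rewrite scaler0 addr0.
- by [].
have ex y : exists w, W w /\ k w = y.
  have [x <-] := ksurj y; have [n [w [Nn Ww ->]]] := NWT x.
  by exists w; rewrite qlinearD // Nn add0r.
pose h y := projT1 (cid (ex y)).
have [hW hK] : (forall y, W (h y)) /\ cancel h k.
  by split=> y; rewrite /h; case: cid => ? [].
exists h; split=> // x y; apply/eqP; rewrite -subr_eq0; apply/eqP.
apply: NW.
  have NB u u' : k u = k u' -> N (u - u').
    move=> kE; apply: (addIr (k u')).
    by rewrite -qlinearD // subrK add0r.
  by apply: NB; rewrite (qlinearD _ _ kL) !hK.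
by apply: qsubspaceB => //; apply: qsubspaceD.
Qed.

End RationalSpaces.

(** * A linearly independent family of reals *)

Section Independent.
Local Open Scope ring_scope.
Local Open Scope classical_set_scope.
Variable R : realType.
Implicit Types (S : nat -> bool).

(* The codes of the prefixes of S: for distinct S these are infinite and almost
   disjoint sets. *)
Definition prefix_code S (k : nat) : bool :=
  if (unpickle k : option (seq bool)) is Some s then s == mkseq S (size s)
  else false.

Definition code_sum S (k : nat) : R :=
  \sum_(j < k) (prefix_code S j)%:R / (j`!)%:R.

Lemma code_sumS S k :
  code_sum S k.+1 = code_sum S k + (prefix_code S k)%:R / (k`!)%:R.
Proof. by rewrite /code_sum big_ord_recr. Qed.

Lemma code_sum_homo S m n : (m <= n)%N -> code_sum S m <= code_sum S n.
Proof.
elim: n => [|n IHn]; first by rewrite leqn0 => /eqP->.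
rewrite leq_eqVlt => /predU1P[->//|]; rewrite ltnS => /IHn /le_trans; apply.
by rewrite code_sumS lerDl divr_ge0.
Qed.

(** The intervals from [code_sum S n] to [code_sum S n + 2/n!] are nested, because
    [1/n! + 2/(n+1)! <= 2/n!] once [n >= 1]. *)
Lemma code_sum_anti S m n : (0 < m)%N -> (m <= n)%N ->
  code_sum S n + 2 / (n`!)%:R <= code_sum S m + 2 / (m`!)%:R.
Proof.
move=> m0; elim: n => [|n IHn]; first by rewrite leqn0 => /eqP->.
rewrite leq_eqVlt => /predU1P[->//|]; rewrite ltnS => mn.
apply: le_trans (IHn mn); rewrite code_sumS -addrA lerD2l.
have n1 : 2 <= n.+1%:R :> R by rewrite ler_nat ltnS (leq_trans m0).
have f0 : 0 < (n`!)%:R :> R by rewrite ltr0n fact_gt0.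
have -> : 2 / (n.+1`!)%:R = (2 / n.+1%:R) / (n`!)%:R :> R.
  by rewrite factS natrM invfM mulrA.
rewrite -mulrDl ler_wpM2r ?invr_ge0 ?(ltW f0)//.
have le1 : 2 / n.+1%:R <= 1 :> R by rewrite ler_pdivrMr ?mul1r// ltr0n.
have le2 : (prefix_code S n)%:R <= 1 :> R by rewrite lern1 leq_b1.
by rewrite (le_trans (lerD le2 le1)).
Qed.

Lemma code_real_exists S : exists z : R, forall k, (0 < k)%N ->
  code_sum S k <= z <= code_sum S k + 2 / (k`!)%:R.
Proof.
pose A := [set code_sum S k | k in [set: nat]].
have ubA k : (0 < k)%N -> ubound A (code_sum S k + 2 / (k`!)%:R).
  move=> k0 _ [j _ <-]; have [jk|/ltnW kj] := leqP j k.
    by rewrite (le_trans (code_sum_homo S jk))// lerDl divr_ge0.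
  by apply: le_trans (code_sum_anti S k0 kj); rewrite lerDl divr_ge0.
exists (sup A) => k k0; apply/andP; split.
  by apply: ub_le_sup; [exists (code_sum S 1 + 2 / (1`!)%:R); apply: ubA|exists k].
by apply: ge_sup; [exists (code_sum S 0), 0%N|exact: ubA].
Qed.

Definition code_real S : R := projT1 (cid (code_real_exists S)).

Lemma code_realP S k : (0 < k)%N ->
  `|code_real S - code_sum S k| <= 2 / (k`!)%:R.
Proof.
rewrite /code_real; case: cid => z zP /= /zP /andP[z1 z2].
rewrite ler_norml; apply/andP; split; last lra.
by rewrite (@le_trans _ _ 0) ?oppr_le0 ?divr_ge0 ?subr_ge0.
Qed.

Lemma common_denominator (T : eqType) (l : seq (rat * T)) :
  exists2 D : int, D != 0 & forall p, p \in l -> D%:~R * p.1 \is a Num.int.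
Proof.
elim: l => [|p l [D D0 Dl]]; first by exists 1.
exists (D * denq p.1); first by rewrite mulf_neq0 ?denq_eq0.
move=> p'; rewrite inE => /predU1P[->|/Dl Dp].
  rewrite -{2}(divq_num_den p.1) intrM -mulrA.
  by rewrite (mulrC (denq _)%:~R) divfK ?intq_eq0 ?denq_eq0 // rpredM // intr_int.
by rewrite intrM mulrAC rpredM // intr_int.
Qed.

(** The sum runs over [j <= k], and then [j!] divides [k!]. *)
Lemma fact_code_sum_int (S : nat -> bool) k :
  (k`!)%:R * code_sum S k.+1 \is a Num.int.
Proof.
rewrite mulr_sumr rpred_sum // => j _; rewrite mulrCA.
rewrite rpredM ?rpred_nat //; have jk : (j <= k)%N by rewrite -ltnS.
have /dvdnP[m ->] : (j`! %| k`!)%N by rewrite -(bin_fact jk) mulnCA dvdn_mulr.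
by rewrite natrM mulfK ?rpred_nat // pnatr_eq0 -lt0n fact_gt0.
Qed.

(* Clearing denominators, a relation between the code reals gives a series
   sum_k a_k / k! = 0 with bounded integers a_k; its partial sums, multiplied by
   factorials, are integers tending to 0, so a_k = 0 for large k. *)
Lemma code_real_relation (l : seq (rat * (nat -> bool))) :
  \sum_(p <- l) ratr p.1 * code_real p.2 = 0 ->
  exists K, forall k, (K <= k)%N ->
    \sum_(p <- l) p.1 * (prefix_code p.2 k)%:R = 0.
Proof.
move=> l0; have [D D0 Dl] := common_denominator l.
pose M : R := \sum_(p <- l) `|D%:~R * ratr p.1|.
have M0 : 0 <= M by rewrite sumr_ge0.
pose T k : R := \sum_(p <- l) D%:~R * ratr p.1 * code_sum p.2 k.
have TE k : T k = \sum_(p <- l) D%:~R * ratr p.1 * (code_sum p.2 k - code_real p.2).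
  under [RHS]eq_bigr do rewrite mulrBr.
  rewrite sumrB -[LHS]subr0; congr (_ - _).
  by under eq_bigr do rewrite -mulrA; rewrite -mulr_sumr l0 mulr0.
(* For [k + 1 >= K] the integer [k! * T (k+1)] has absolute value at most [2M/(k+1) < 1], hence is
   0. *)
have [K KM] : exists K, 2 * M < K%:R.
  by exists (Num.truncn (2 * M)).+1; exact: truncnS_gt.
have T0 k : (K <= k.+1)%N -> T k.+1 = 0.
  move=> Kk; have f0 : 0 < (k`!)%:R :> R by rewrite ltr0n fact_gt0.
  have Tint : (k`!)%:R * T k.+1 \is a Num.int.
    rewrite mulr_sumr big_seq rpred_sum // => p pl.
    rewrite mulrCA rpredM ?fact_code_sum_int //.
    have /intrP[m mE] := Dl p pl.
    by rewrite -[D%:~R](ratr_int R) -rmorphM /= mE ratr_int intr_int.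
  have Tle : `|T k.+1| <= M * (2 / (k.+1`!)%:R).
    rewrite TE (le_trans (ler_norm_sum _ _ _)) // mulr_suml ler_sum // => p _.
    by rewrite normrM ler_wpM2l // distrC code_realP.
  have Tlt : `|(k`!)%:R * T k.+1| < 1.
    rewrite normrM (gtr0_norm f0).
    apply: (@le_lt_trans _ _ ((k`!)%:R * (M * (2 / (k.+1`!)%:R)))).
      by rewrite ler_pM2l.
    rewrite factS natrM [X in X < _](_ : _ = 2 * M / k.+1%:R).
      by rewrite ltr_pdivrMr ?ltr0n // mul1r (lt_le_trans KM) // ler_nat.
    by field; rewrite nat1r !pnatr_eq0 -!lt0n fact_gt0.
  have /eqP : (k`!)%:R * T k.+1 = 0.
    have /intrP[m mE] := Tint; move: Tlt; rewrite mE -intr_norm.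
    by rewrite ltrz1; case: m {mE} => [[|m]|m].
  by rewrite mulf_eq0 gt_eqF //= => /eqP.
(* The difference of two consecutive values of [T], both 0 here, isolates the term of index
   [k + 1]. *)
exists K.+1 => -[//|k] Kk.
have : T k.+2 - T k.+1 = 0 by rewrite !T0 ?subrr ?(leqW (ltnW Kk)) ?(ltnW Kk).
rewrite -sumrB.
have -> : \sum_(p <- l) (D%:~R * ratr p.1 * code_sum p.2 k.+2 -
    D%:~R * ratr p.1 * code_sum p.2 k.+1) =
  D%:~R / (k.+1`!)%:R * ratr (\sum_(p <- l) p.1 * (prefix_code p.2 k.+1)%:R) :> R.
  rewrite rmorph_sum mulr_sumr; apply: eq_bigr => p _.
  rewrite code_sumS rmorphM /= ratr_nat -mulrBr addrAC subrr add0r.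
  by rewrite [X in _ * X = _]mulrC mulrACA.
move=> /eqP; rewrite mulf_eq0 fmorph_eq0 mulf_eq0 intr_eq0 (negPf D0) invr_eq0.
by rewrite pnatr_eq0 eqn0Ngt fact_gt0 /= => /eqP.
Qed.

(** Pigeonhole: otherwise [K + 1] consecutive arguments would have distinct values below [K]. *)
Lemma injective_unbounded (g : nat -> nat) m K : injective g ->
  exists2 n, (m <= n)%N & (K <= g n)%N.
Proof.
move=> ginj; apply: contrapT => noN.
have gK n : (m <= n)%N -> (g n < K)%N.
  by move=> mn; rewrite ltnNge; apply/negP => Kg; apply: noN; exists n.
pose f (i : 'I_K.+1) : 'I_K := Ordinal (gK (m + i)%N (leq_addr _ _)).
have /leq_card : injective f.
  by move=> i j [] /ginj /addnI /val_inj.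
by rewrite !card_ord ltnn.
Qed.

(** The code of a prefix of [S0] long enough to differ from the prefixes of all other members of [l]
    will do; there are infinitely many such codes, so some exceed [K]. *)
Lemma prefix_code_separates (l : seq (nat -> bool)) S0 K :
  exists2 k, (K <= k)%N & forall S, S \in l -> prefix_code S k = (S == S0).
Proof.
have [m mP] : exists m, forall S, S \in l -> S != S0 ->
    exists2 i, (i < m)%N & S i != S0 i.
  elim: l => [|S l [m mP]]; first by exists 0%N.
  have [->|SS0] := eqVneq S S0.
    by exists m => S'; rewrite inE => /predU1P[->|/mP//]; rewrite eqxx.
  have [i iP] : exists i, S i != S0 i.
    apply: contrapT => noi; move/eqP: SS0; apply; apply/funext => i.
    by apply/eqP; apply: contrapT => /negP ?; apply: noi; exists i.
  exists (maxn m i.+1) => S'; rewrite inE => /predU1P[->|S'l] S'0.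
    by exists i => //; rewrite leq_maxr.
  by have [j jm ?] := mP _ S'l S'0; exists j => //; rewrite (leq_trans jm) ?leq_maxl.
have [|n mn Kn] := @injective_unbounded (fun n => pickle (mkseq S0 n)) m K.
  move=> i j /(congr1 (fun k => unpickle k : option (seq bool))).
  by rewrite !pickleK => -[] /(congr1 size); rewrite !size_mkseq.
exists (pickle (mkseq S0 n)) => // S Sl.
rewrite /prefix_code pickleK size_mkseq.
have [->|SS0] := eqVneq S S0; first exact: eqxx.
have [i im iP] := mP _ Sl SS0; apply: contraNF iP => /eqP.
have iN := leq_trans im mn.
by move=> /(congr1 (fun s => nth false s i)); rewrite !nth_mkseq // => ->.
Qed.

(** Linear independence of the code reals, in the form that [qlinear_extension] requires. Evaluating
    the relation at a code that separates [S] from the rest of [l] shows that the coefficients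
    attached to [S] sum to 0. *)
Lemma code_real_free (F : lmodType R) (v : (nat -> bool) -> F)
    (l : seq (rat * (nat -> bool))) :
  \sum_(p <- l) ratr p.1 *: (code_real p.2 : R^o) = 0 ->
  \sum_(p <- l) ratr p.1 *: v p.2 = 0.
Proof.
move=> /code_real_relation[K KP].
pose s := undup (unzip2 l).
have -> : \sum_(p <- l) ratr p.1 *: v p.2 =
    \sum_(S <- s) \sum_(p <- l | p.2 == S) ratr p.1 *: v p.2.
  rewrite (exchange_big_dep predT) //= big_seq [RHS]big_seq; apply: eq_bigr => p pl.
  rewrite -big_filter (_ : [seq _ <- _ | _] = [:: p.2]) ?big_seq1 //.
  rewrite (eq_filter (a2 := pred1 p.2)); last by move=> S; rewrite /= eq_sym.
  by rewrite filter_pred1_uniq ?undup_uniq // mem_undup map_f.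
rewrite big1 // => S _.
have [k Kk kP] := prefix_code_separates (unzip2 l) S K.
have : \sum_(p <- l | p.2 == S) p.1 = 0.
  rewrite -[RHS](KP k Kk) big_mkcond /= big_seq [RHS]big_seq.
  apply: eq_bigr => p pl; rewrite kP ?map_f //.
  by case: eqP => _; rewrite ?mulr1 ?mulr0.
move=> S0; under eq_bigr => p /eqP -> do over.
by rewrite -scaler_suml -rmorph_sum S0 rmorph0 scale0r.
Qed.

Lemma code_real_neq0 S : code_real S != 0.
Proof.
apply/eqP => z0.
have := @code_real_free R^o (fun=> 1) [:: (1, S)].
rewrite !big_seq1 /= rmorph1 !scale1r => /(_ z0) /eqP.
by rewrite oner_eq0.
Qed.

Lemma code_real_extension (F : lmodType R) (v : (nat -> bool) -> F) :
  exists k : R^o -> F, qlinear k /\ forall S, k (code_real S) = v S.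
Proof. by apply: qlinear_extension => l; apply: code_real_free. Qed.

Lemma rat_multiple_in_itv (z a b : R) : z != 0 -> a < b ->
  exists2 q : rat, q != 0 & a < ratr q * z < b.
Proof.
have dense (c e : R) : c < e -> exists2 q : rat, q != 0 & c < ratr q < e.
  move=> /rat_in_itvoo[q]; rewrite in_itv /= => /andP[cq qe].
  have [q0|q0] := eqVneq q 0; last by exists q; rewrite ?q0 ?cq ?qe.
  (* If the rational found is 0, another one is taken between 0 and [e]. *)
  rewrite q0 rmorph0 in cq qe.
  have [q' + ] := rat_in_itvoo qe; rewrite in_itv /= => /andP[q'0 q'e].
  by exists q'; [rewrite ltr0q in q'0; rewrite gt_eqF|rewrite q'e (lt_trans cq)].
move=> z0 ab; have [zp|zn|/eqP] := ltgtP 0 z; last by rewrite eq_sym (negPf z0).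
  have [|q q0 /andP[aq qb]] := dense (a / z) (b / z).
    by rewrite ltr_pM2r // invr_gt0.
  by exists q; rewrite // -ltr_pdivrMr // aq -ltr_pdivlMr.
have [|q q0 /andP[bq qa]] := dense (b / z) (a / z).
  by rewrite ltr_nM2r // invr_lt0.
by exists q; rewrite // -ltr_ndivlMr // qa -ltr_ndivrMr.
Qed.

(** * Closed subsets of the plane and rational boxes *)

Definition plane_open (U : R -> R -> Prop) := forall x y, U x y ->
  exists2 e, 0 < e & forall x' y', `|x - x'| < e -> `|y - y'| < e -> U x' y'.

(** Open squares with rational centre and half-side, numbered by [pickle]; a number that codes no
    triple gives the empty set. *)
Definition rat_box (n : nat) (x y : R) : Prop :=
  if (unpickle n : option (rat * rat * rat)) is Some (c1, c2, r) then
    `|x - ratr c1| < ratr r /\ `|y - ratr c2| < ratr r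
  else False.

Lemma rat_box_basis (U : R -> R -> Prop) x y : plane_open U -> U x y ->
  exists2 n, rat_box n x y & forall x' y', rat_box n x' y' -> U x' y'.
Proof.
move=> Uo /Uo[e e0 eU].
have [|r] := @rat_in_itvoo R 0 (e / 2); first by rewrite divr_gt0.
rewrite in_itv /= => /andP[r0 re].
have near (t : R) : exists c : rat, `|t - ratr c| < ratr r.
  have [|c] := @rat_in_itvoo R (t - ratr r) (t + ratr r); first lra.
  by rewrite in_itv /= => /andP[? ?]; exists c; rewrite ltr_norml; lra.
have [[c1 c1P] [c2 c2P]] := (near x, near y).
exists (pickle (c1, c2, r)); first by rewrite /rat_box pickleK.
move=> x' y'; rewrite /rat_box pickleK !ltr_norml => -[h1 h2].
move: c1P c2P; rewrite !ltr_norml => h3 h4.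
by apply: eU; rewrite ltr_norml; lra.
Qed.

(* Closed subsets of the plane are coded by the set S of rational boxes that they
   miss, and a nonzero rational multiple of code_real S can be placed in any
   interval, so all the closed sets can be treated at once. *)
Lemma additive_graph_meets_closed : exists g : R -> R,
  {morph g : x y / x + y} /\
  forall U, plane_open U ->
    (exists a b, a < b /\ forall x, a < x < b -> exists y, ~ U x y) ->
    exists x, ~ U x (g x).
Proof.
pose K S x y := forall n, S n -> ~ rat_box n x y.
pose good S (p : rat * R) := p.1 != 0 /\ K S (ratr p.1 * code_real S) p.2.
(* For every [S] at once, a nonzero rational [q] and an ordinate are chosen so that the point above
   [q * code_real S] lies in [K S]; [(0, 0)] is the default where there is none. *)
have /choice[c cP] S : exists p : rat * R, (exists p, good S p) -> good S p.
  by have [[p Sp]|noS] := pselect (exists p, good S p);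
    [exists p|exists (0, 0)].
(* Dividing by the rational factor makes [g] take the chosen ordinate at the chosen abscissa. *)
have [g [gL gE]] := @code_real_extension R^o (fun S => (c S).2 / ratr (c S).1).
exists g; split; first by move=> x y; exact: (@qlinearD _ R^o R^o g x y gL).
move=> U Uo [a [b [ab Kab]]].
(* For the set of boxes contained in [U], [K S] is the complement of [U]. *)
pose S n := `[< forall x y, rat_box n x y -> U x y >].
have KU x y : K S x y <-> ~ U x y.
  split=> [Kxy /(rat_box_basis Uo)[n nxy nU]|nU n /asboolP nP /nP//].
  by apply: (Kxy n) => //; apply/asboolP.
have [q q0 qab] := rat_multiple_in_itv (code_real_neq0 S) ab.
have [y /KU Ky] := Kab _ qab.
have [c0 cK] : good S (c S) by apply: cP; exists (q, y).
exists (ratr (c S).1 * code_real S); apply/KU.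
suff -> : g (ratr (c S).1 * code_real S) = (c S).2 by [].
have := @qlinearZ _ R^o R^o g (c S).1 (code_real S) gL; rewrite gE => ->.
by rewrite /GRing.scale /= mulrCA mulfV ?mulr1 // fmorph_eq0.
Qed.

(* h is a section of a Q-linear k with k (code_real (code x)) = x; a nonzero real in
   the kernel of k is not in the range of h. *)
Lemma injective_additive_codim d : exists h : 'rV[R]_d -> R,
  [/\ {morph h : x y / x + y}, forall x, h x = 0 -> x = 0 &
    exists2 w, w != 0 & forall x (q : rat), h x = ratr q * w -> h x = 0].
Proof.
(* Entry 0 is always true, which keeps the constantly false sequence [S0] free for [w]; the other
   entries record the rationals below each coordinate. *)
pose code (x : 'rV[R]_d) (n : nat) : bool := if n is n'.+1 then
  if (unpickle n' : option ('I_d * rat)) is Some (i, q) then ratr q < x 0 i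
  else false else true.
have code_inj : injective code.
  have lt_code x y i : code x = code y -> ~ x 0 i < y 0 i.
    move=> E /rat_in_itvoo[q]; rewrite in_itv /= => /andP[xq qy].
    have := congr1 (fun s => s (pickle (i, q)).+1) E.
    by rewrite /code pickleK qy ltNge (ltW xq).
  move=> x y E; apply/rowP => i.
  by have [/(lt_code _ _ _ E)|/(lt_code _ _ _ (esym E))|] := ltgtP (x 0 i) (y 0 i).
have /choice[v vP] S : exists x, forall y, code y = S -> x = y.
  have [[x xS]|noS] := pselect (exists x, code x = S).
    by exists x => y yS; apply: code_inj; rewrite xS yS.
  by exists 0 => y yS; case: noS; exists y.
pose S0 : nat -> bool := fun=> false.
have [k [kL kE]] := code_real_extension (fun S => if S == S0 then 0 else v S).
have kcode x : k (code_real (code x)) = x.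
  by rewrite kE; case: eqP => [/(congr1 (fun s => s 0%N))//|_]; exact: vP.
have [|h [hD hK]] := qlinear_section kL; first by move=> x; exists (code_real (code x)).
have h0 : h 0 = 0 by apply: (addIr (h 0)); rewrite -hD !add0r.
exists h; split=> //.
  by move=> x hx; rewrite -[x]hK hx qlinear0.
exists (code_real S0); first exact: code_real_neq0.
move=> x q hx; suff -> : x = 0 by [].
rewrite -[x]hK hx -[_ * _]/(ratr q *: (code_real S0 : R^o)) qlinearZ //.
by rewrite kE eqxx scaler0.
Qed.

End Independent.

(** * Closed subgroups of Euclidean space *)

Section Rowspace.
Local Open Scope ring_scope.

(** Among the matrices with rows in [V], one of largest rank is taken; a vector of [V] outside its
    row space would raise the rank. *)
Lemma subspace_rowspace (F : fieldType) n (V : 'rV[F]_n -> Prop) :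
  V 0 -> (forall a u v, V u -> V v -> V (a *: u + v)) ->
  exists A : 'M[F]_n, forall v, V v <-> (v <= A)%MS.
Proof.
move=> V0 VL.
have VD u v : V u -> V v -> V (u + v) by move=> Vu Vv; rewrite -[u]scale1r; apply: VL.
have VM m (D : 'rV_m) (A : 'M_(m, n)) : (forall i, V (row i A)) -> V (D *m A).
  move=> AV; rewrite mulmx_sum_row; elim/big_ind: _ => // i _.
  by rewrite -[_ *: _]addr0; apply: VL.
pose P r := `[< exists A : 'M[F]_n, (forall i, V (row i A)) /\ \rank A = r >].
have exP : exists r, P r.
  exists 0%N; apply/asboolP; exists 0; rewrite mxrank0; split=> // i.
  by rewrite row0.
have leP r : P r -> (r <= n)%N by move=> /asboolP[A [_ <-]]; exact: rank_leq_col.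
case: (ex_maxnP exP leP) => r /asboolP[A [AV rA]] rmax.
exists A => v; split=> [Vv|/submxP[D ->]]; last exact: VM.
apply: contrapT => /negP vA.
have : (A < A + v)%MS by rewrite ltmxE addsmxSl /= addsmx_sub submx_refl.
rewrite ltmxErank => /andP[_]; rewrite rA ltnNge => /negP; apply; apply: rmax.
apply/asboolP; exists (A + v)%MS; split=> // i.
have /sub_addsmxP[[u1 u2] /= ->] := row_sub i (A + v)%MS.
by apply: VD; apply: VM => // j; rewrite row_id.
Qed.

End Rowspace.

Section ClosedSubgroup.
Local Open Scope ring_scope.
Local Open Scope classical_set_scope.
Variables (R : realType) (n : nat).
Implicit Types (u v w h : 'rV[R]_n).

Lemma ler_coord_norm v i : `|v 0 i| <= `|v|.
Proof.
by rewrite [leRHS]mx_normrE; apply: (le_bigmax _ (fun ij => `|v ij.1 ij.2|) (0, i)).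
Qed.

Lemma norm_le_coord v (e : R) : 0 <= e -> (forall i, `|v 0 i| <= e) -> `|v| <= e.
Proof.
move=> e0 ve; rewrite [leLHS]mx_normrE; apply: bigmax_le => // -[i j] _ /=.
by rewrite ord1.
Qed.

Lemma mulmx_bounded (M : 'M[R]_n) :
  exists2 c : R, 0 <= c & forall v, `|v *m M| <= c * `|v|.
Proof.
exists (\sum_i \sum_j `|M i j|).
  by apply: sumr_ge0 => i _; apply: sumr_ge0.
move=> v; apply: norm_le_coord.
  by rewrite mulr_ge0 // sumr_ge0 // => i _; apply: sumr_ge0.
move=> j; rewrite mxE (le_trans (ler_norm_sum _ _ _)) // mulr_suml ler_sum // => i _.
rewrite normrM mulrC ler_pM ?ler_coord_norm //.
by rewrite (bigD1 j) //= lerDl sumr_ge0.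
Qed.

(* Otherwise, modulo the largest subspace V inside H, there are nonzero elements
   of H tending to 0, and a limit of their directions spans a line inside H that
   is not inside V. *)
Lemma closed_subgroup_small (H : set 'rV[R]_n) : closed H -> H 0 ->
  (forall u v, H u -> H v -> H (u - v)) ->
  exists2 e : R, 0 < e & forall h, H h -> `|h| < e -> forall t, H (t *: h).
Proof.
move=> Hc H0 HB.
have HN u : H u -> H (- u) by move=> Hu; rewrite -sub0r; apply: HB.
have HD u v : H u -> H v -> H (u + v) by move=> Hu Hv; rewrite -[v]opprK; apply/HB/HN.
have HZ u (m : int) : H u -> H (u *~ m).
  have Hn (k : nat) : H u -> H (u *+ k).
    by move=> Hu; elim: k => // k IHk; rewrite mulrS; apply: HD.
  by case: m => m Hu; [exact: Hn|apply/HN/Hn].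
pose V := [set v | forall t, H (t *: v)].
have [|a u v Vu Vv t|A AP] := @subspace_rowspace R n V.
- by move=> t; rewrite scaler0.
- by rewrite scalerDr scalerA; apply: HD.
(* The projection onto [V] along a complement. *)
pose P := proj_mx A A^C%MS.
have AC : (A :&: A^C)%MS = 0 by apply/eqP; rewrite -submx0 (capmx_compl A).
apply: contrapT => noe.
have [c c0 cP] := mulmx_bounded P.
(* A small [h] outside [V] is replaced by [h - h P]: this is nonzero, still in [H], killed by [P],
   and at most [1 + c] times as long. *)
have wex e : 0 < e -> exists w, [/\ H w, w != 0, `|w| < e & w *m P = 0].
  move=> e0; apply: contrapT => now; apply: noe.
  exists (e / (1 + c)); first by rewrite divr_gt0 // ltr_pwDl.
  move=> h Hh he; apply: contrapT => nV.
  have hP : V (h *m P) by apply/AP; exact: proj_mx_sub.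
  apply: now; exists (h - h *m P); split.
  - by apply: HB => //; have := hP 1; rewrite scale1r.
  - by apply/eqP => /subr0_eq hE; apply: nV; rewrite hE.
  - apply: le_lt_trans (ler_normB _ _) _.
    apply: (@le_lt_trans _ _ ((1 + c) * `|h|)).
      by rewrite mulrDl mul1r lerD2l.
    by rewrite mulrC -ltr_pdivlMr // ltr_pwDl.
  - rewrite mulmxBl [X in _ - X](proj_mx_id AC) ?subrr //; exact: proj_mx_sub.
have /choice[w wP] (k : nat) : exists w,
    [/\ H w, w != 0, `|w| < k.+1%:R^-1 & w *m P = 0].
  by apply: wex; rewrite invr_gt0.
pose x k := `|w k|^-1 *: w k.
have wgt0 k : 0 < `|w k| by rewrite normr_gt0; have [] := wP k.
have xE k : w k = `|w k| *: x k by rewrite scalerA mulfV ?scale1r // gt_eqF.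
have x1 k : `|x k| = 1.
  by rewrite normrZ normfV normr_id mulVf // gt_eqF.
have : compact [set v : 'rV[R]_n | `|v| <= 1].
  apply: bounded_closed_compact.
    by exists 1; split=> // M M1 v /= v1; rewrite (le_trans v1) // ltW.
  have -> : [set v : 'rV[R]_n | `|v| <= 1] = Num.norm @^-1` [set r : R | r <= 1] by [].
  by apply: closed_comp; [move=> v _; exact: norm_continuous|exact: closed_le].
move=> /(_ (x @ \oo) _)[|u [_ ucl]]; first by exists 0%N => // k _ /=; rewrite x1.
have {ucl} uP (N : nat) e : 0 < e -> exists2 k, (N <= k)%N & `|u - x k| < e.
  move=> e0.
  have [|_ [[k Nk <-]]] := ucl (x @` [set k | (N <= k)%N]) _ _ (nbhsx_ballx u e e0).
    by exists N => // k /= Nk; exists k.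
  by rewrite -ball_normE /=; exists k.
have uPz : u *m P = 0.
  apply/eqP; rewrite -normr_le0; apply/ler_addgt0Pr => e e0; rewrite add0r.
  have c1 : 0 < 1 + c by rewrite ltr_pwDl.
  have [k _ ke] := uP 0%N (e / (1 + c)) (divr_gt0 e0 c1).
  have -> : u *m P = (u - x k) *m P.
    by rewrite mulmxBl -scalemxAl; have [_ _ _ ->] := wP k; rewrite scaler0 subr0.
  apply: le_trans (cP _) _; apply: (@le_trans _ _ ((1 + c) * `|u - x k|)).
    by rewrite ler_wpM2r // lerDr.
  by rewrite mulrC -ler_pdivlMr // ltW.
(* Integer multiples of the short vectors [w k] approximate every point of the line through [u]:
   rounding [t / |w k|] down costs at most [|w k|]. *)
have uV : V u.
  move=> t; apply: Hc => B /nbhs_ballP[e /= e0 eB].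
  have t1 : 0 < 1 + `|t| by rewrite ltr_pwDl.
  have [N NP] : exists N : nat, N.+1%:R^-1 < e / 2.
    exists (Num.truncn (e / 2)^-1).
    by rewrite invf_plt ?posrE ?divr_gt0 ?ltr0n //; exact: truncnS_gt.
  have [k Nk ke] := uP N (e / 2 / (1 + `|t|)) ltac:(by rewrite !divr_gt0).
  have we : `|w k| < e / 2.
    have [_ _ wk _] := wP k; apply: lt_trans wk _; apply: le_lt_trans NP.
    by rewrite lef_pV2 ?posrE ?ltr0n // ler_nat ltnS.
  pose m := Num.floor (t / `|w k|).
  exists (w k *~ m); split; first by apply: HZ; have [] := wP k.
  apply: eB; rewrite -ball_normE /=.
  have -> : t *: u - w k *~ m = t *: (u - x k) + (t - m%:~R * `|w k|) *: x k.
    rewrite scalerBr scalerBl addrA subrK -scalerA -xE; congr (_ - _).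
    by rewrite scaler_int.
  apply: le_lt_trans (ler_normD _ _) _; rewrite (normrZ t) (normrZ (t - _)) x1 mulr1.
  have le1 : `|t| * `|u - x k| <= e / 2.
    apply: (@le_trans _ _ ((1 + `|t|) * `|u - x k|)).
      by rewrite ler_wpM2r // lerDr.
    by rewrite mulrC -ler_pdivlMr // ltW.
  have le2 : `|t - m%:~R * `|w k| | <= `|w k|.
    have /andP[m1 m2] := floor_itv (t / `|w k|).
    rewrite ler_pdivlMr // -/m in m1; rewrite ltr_pdivrMr // -/m intrD mulrDl mul1r in m2.
    by rewrite ler_norml; lra.
  by lra.
have : u = 0 by rewrite -uPz (proj_mx_id AC) //; apply/AP.
move=> u0; have [k _] := uP 0%N 1 ltr01.
by rewrite u0 sub0r normrN x1 ltxx.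
Qed.

End ClosedSubgroup.

(** * Connectedness of intervals, and closures in coordinates *)

Section Coordinates.
Local Open Scope ring_scope.
Local Open Scope classical_set_scope.
Variable R : realType.

Definition open_line (P : R -> Prop) := forall x, P x ->
  exists2 e, 0 < e & forall y, `|x - y| < e -> P y.

Lemma segment_not_separated (P1 P2 : R -> Prop) a b :
  open_line P1 -> open_line P2 -> a <= b ->
  (forall x, a <= x <= b -> P1 x \/ P2 x) ->
  (forall x, a <= x <= b -> P1 x -> P2 x -> False) -> P1 a -> P1 b.
Proof.
have openP (P : set R) : open_line P -> open P.
  by rewrite openE => Po x /Po[e e0 eP]; apply/nbhs_ballP; exists e.
move=> /openP P1o /openP P2o ab cov disj P1a.
have abP x : `[a, b]%classic x = (a <= x <= b) by rewrite /= in_itv.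
suff E : `[a, b]%classic `&` P1 = `[a, b]%classic.
  have [] // : (`[a, b]%classic `&` P1) b by rewrite E abP ab lexx.
apply: (@segment_connected R a b).
- by exists a; split=> //; rewrite abP lexx ab.
- by exists P1.
- exists (~` P2); first exact: open_closedC.
  apply/seteqP; split=> x [xab Px]; split=> //.
    by move=> P2x; apply: (disj x) => //; rewrite -abP.
  by have [|//|//] := cov x; rewrite -abP.
Qed.

(** Membership in the closure of [G], expressed with the sup distance. *)
Definition adherent n (G : ('I_n -> R) -> Prop) (v : 'I_n -> R) : Prop :=
  forall e, 0 < e -> exists2 g, G g & forall i, `|g i - v i| < e.

Lemma adherent_subgroup_small n (G : ('I_n -> R) -> Prop) :
  G (fun=> 0) -> (forall u v, G u -> G v -> G (fun i => u i - v i)) ->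
  exists2 e, 0 < e & forall h, adherent G h -> (forall i, `|h i| < e) ->
    forall t, adherent G (fun i => t * h i).
Proof.
move=> G0 GB.
pose H := [set v : 'rV[R]_n | adherent G (v 0)].
have [|||e e0 eH] := @closed_subgroup_small R n H.
- move=> v vcl e e0.
  have e2 : 0 < e / 2 by rewrite divr_gt0.
  have [w [wH]] := vcl _ (nbhsx_ballx v _ e2).
  rewrite -ball_normE /= => vw.
  have [g Gg gw] := wH _ e2; exists g => // i.
  have := le_lt_trans (ler_coord_norm (v - w) i) vw; rewrite !mxE.
  by move: (gw i); rewrite !ltr_norml; lra.
- by move=> e e0; exists (fun=> 0) => // i; rewrite mxE subrr normr0.
- move=> u v uH vH e e0.
  have e2 : 0 < e / 2 by rewrite divr_gt0.
  have [[g Gg gu] [g' Gg' gv]] := (uH _ e2, vH _ e2).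
  exists (fun i => g i - g' i); first exact: GB.
  by move=> i; rewrite !mxE; move: (gu i) (gv i); rewrite !ltr_norml; lra.
have rowE (h : 'I_n -> R) : (\row_i h i) 0 = h by apply/funext => i; rewrite mxE.
(* Halving restores strictness, since coordinate bounds control the norm only by a non-strict
   inequality. *)
exists (e / 2); first by rewrite divr_gt0.
move=> h Gh he t.
have tE : (t *: \row_i h i) 0 = fun i => t * h i by apply/funext => i; rewrite !mxE.
rewrite -tE; apply: eH; first by rewrite /H /mkset rowE.
apply: (@le_lt_trans _ _ (e / 2)); last lra.
by apply: norm_le_coord => [|i]; rewrite ?mxE ?ltW // divr_gt0.
Qed.

End Coordinates.

(** * Components of the graph *)

Section Euclidean.
Local Open Scope ring_scope.

Lemma distE n (x y : Rn n) : dist x y = Num.sqrt (\sum_i (x i - y i) ^+ 2).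
Proof.
rewrite /dist RsqrtE; congr Num.sqrt.
by apply: eq_bigr => i _; rewrite RpowE.
Qed.

Lemma coord_le_dist n (x y : Rn n) i : `|x i - y i| <= dist x y.
Proof.
rewrite distE -sqrtr_sqr ler_wsqrtr // (bigD1 i) //= lerDl.
by apply: sumr_ge0 => j _; apply: sqr_ge0.
Qed.

(** With [coord_le_dist], this makes the Euclidean and sup topologies agree. It rests on
    [n (e/(n+1))^2 < e^2]; the [n + 1] also covers dimension 0. *)
Lemma dist_lt_coord n (x y : Rn n) (e : R) : 0 < e ->
  (forall i, `|x i - y i| < e / n.+1%:R) -> dist x y < e.
Proof.
move=> e0 xy; rewrite distE -[ltRHS](gtr0_norm e0) -sqrtr_sqr.
have n0 : 0 < n.+1%:R :> R by rewrite ltr0n.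
rewrite ltr_sqrt ?exprn_gt0 //.
apply: (@le_lt_trans _ _ (\sum_(i < n) (e / n.+1%:R) ^+ 2)).
  apply: ler_sum => i _; rewrite -real_normK ?num_real //.
  by apply: lerXn2r; rewrite ?nnegrE ?divr_ge0 ?(ltW e0) ?(ltW (xy i)).
rewrite sumr_const card_ord -[_ *+ n]mulr_natl expr_div_n mulrCA.
rewrite gtr_pMr ?exprn_gt0 // ltr_pdivrMr ?exprn_gt0 // mul1r.
by rewrite -natrX ltr_nat; nia.
Qed.

Definition close n (e : R) (x y : Rn n) := forall i, `|x i - y i| < e.

Lemma is_openP n (U : Rn n -> Prop) : is_open U <->
  forall x, U x -> exists2 e, 0 < e & forall y, close e x y -> U y.
Proof.
split=> Uo x /Uo[e].
  move=> [/RltP e0 eU]; exists (e / n.+1%:R); first by rewrite divr_gt0 ?ltr0n.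
  by move=> y xy; apply/eU/RltP/dist_lt_coord.
move=> e0 eU; exists e; split; first exact/RltP.
by move=> y /RltP xy; apply: eU => i; apply: le_lt_trans (coord_le_dist _ _ _) xy.
Qed.

Lemma dense_inP n (G V : Rn n -> Prop) :
  dense_in G V <-> forall v, V v -> adherent G v.
Proof.
split=> GV v /GV vG e.
  move=> /RltP/vG[g [Gg /RltP gv]]; exists g => // i.
  by apply: le_lt_trans (coord_le_dist _ _ _) gv.
move=> /RltP e0; have [|g Gg gv] := vG (e / n.+1%:R); first by rewrite divr_gt0 ?ltr0n.
by exists g; split=> //; apply/RltP/dist_lt_coord.
Qed.

Lemma connected_image n m (phi : Rn n -> Rn m) (S : Rn n -> Prop) :
  (forall x e, 0 < e -> exists2 e', 0 < e' &
     forall y, close e' x y -> close e (phi x) (phi y)) ->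
  connected S -> connected (fun q => exists2 p, S p & q = phi p).
Proof.
move=> phic Sc U1 U2 /is_openP U1o /is_openP U2o cov disj.
have pre (U : Rn m -> Prop) :
    (forall x, U x -> exists2 e, 0 < e & forall y, close e x y -> U y) ->
    is_open (fun p => U (phi p)).
  move=> Uo; apply/is_openP => x /Uo[e e0 eU]; have [e' e'0 e'P] := phic x e e0.
  by exists e' => // y /e'P /eU.
have [||h|h] := Sc _ _ (pre _ U1o) (pre _ U2o).
- by move=> p Sp; apply: cov; exists p.
- by move=> p Sp; apply: disj; exists p.
- by left=> _ [p Sp ->]; apply: h.
- by right=> _ [p Sp ->]; apply: h.
Qed.

Lemma connected_union n (A B : Rn n -> Prop) p : A p -> B p ->
  connected A -> connected B -> connected (fun q => A q \/ B q).
Proof.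
move=> Ap Bp Ac Bc U1 U2 U1o U2o cov disj.
have [||A1|A2] := Ac U1 U2 U1o U2o.
- by move=> x Ax; apply: cov; left.
- by move=> x Ax; apply: disj; left.
- have [||B1|B2] := Bc U1 U2 U1o U2o.
  + by move=> x Bx; apply: cov; right.
  + by move=> x Bx; apply: disj; right.
  + by left=> x [/A1|/B1].
  + by case: (disj p); [left|apply: A1|apply: B2].
- have [||B1|B2] := Bc U1 U2 U1o U2o.
  + by move=> x Bx; apply: cov; right.
  + by move=> x Bx; apply: disj; right.
  + by case: (disj p); [left|apply: B1|apply: A2].
  + by right=> x [/A2|/B2].
Qed.

Lemma connected_translate n (S : Rn n -> Prop) (tau : Rn n) :
  connected S -> connected (fun q => S (vsub q tau)).
Proof.
move=> Sc; have := @connected_image n n (fun p => vadd p tau) S.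
have -> : (fun q => S (vsub q tau)) = (fun q => exists2 p, S p & q = vadd p tau).
  apply/funext => q; apply/propext; split=> [Sq|[p Sp ->]].
    exists (vsub q tau) => //; apply/funext => i.
    by rewrite /vadd /vsub !RealsE subrK.
  rewrite (_ : vsub _ _ = p) //; apply/funext => i.
  by rewrite /vadd /vsub !RealsE addrK.
apply=> // x e e0; exists e => // y xy i.
by rewrite /vadd !RealsE opprD addrACA subrr addr0; apply: xy.
Qed.

Lemma connected_segment n (a b : Rn n) :
  connected (fun q => exists2 t : R, 0 <= t <= 1 &
    q = fun i => a i + t * (b i - a i)).
Proof.
move=> U1 U2 /is_openP U1o /is_openP U2o cov disj.
pose phi (t : R) : Rn n := fun i => a i + t * (b i - a i).
(* A Lipschitz constant of [phi] for the sup distance; the summand 1 makes it positive. *)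
pose M : R := 1 + \sum_i `|b i - a i|.
have M0 : 0 < M by rewrite ltr_pwDl // sumr_ge0.
have pre (U : Rn n -> Prop) :
    (forall x, U x -> exists2 e, 0 < e & forall y, close e x y -> U y) ->
    open_line (fun t => U (phi t)).
  move=> Uo t /Uo[e e0 eU]; exists (e / M); first by rewrite divr_gt0.
  move=> t' tt'; apply: eU => i; rewrite /phi opprD addrACA subrr add0r -mulrBl.
  rewrite normrM; apply: (@le_lt_trans _ _ (`|t - t'| * M)).
    rewrite ler_wpM2l //; apply: (@le_trans _ _ (\sum_i `|b i - a i|)).
      by rewrite (bigD1 i) //= lerDl sumr_ge0.
    by rewrite lerDr.
  by rewrite -ltr_pdivlMr.
have sep (V1 V2 : Rn n -> Prop) :
    (forall x, V1 x -> exists2 e, 0 < e & forall y, close e x y -> V1 y) ->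
    (forall x, V2 x -> exists2 e, 0 < e & forall y, close e x y -> V2 y) ->
    (forall t, 0 <= t <= 1 -> V1 (phi t) \/ V2 (phi t)) ->
    (forall t, 0 <= t <= 1 -> V1 (phi t) -> V2 (phi t) -> False) ->
    V1 (phi 0) -> forall t, 0 <= t <= 1 -> V1 (phi t).
  move=> V1o V2o cov' disj' V10 t /andP[t0 t1].
  apply: (segment_not_separated (pre _ V1o) (pre _ V2o) t0) => //.
    by move=> s /andP[s0 st]; apply: cov'; rewrite s0 (le_trans st).
  by move=> s /andP[s0 st]; apply: disj'; rewrite s0 (le_trans st).
have cov' t : 0 <= t <= 1 -> U1 (phi t) \/ U2 (phi t) by move=> t01; apply: cov; exists t.
have disj' t : 0 <= t <= 1 -> U1 (phi t) -> U2 (phi t) -> False.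
  by move=> t01; apply: disj; exists t.
have [|U10|U20] := cov' 0; first by rewrite lexx ler01.
  by left=> _ [t t01 ->]; apply: (sep U1 U2).
right=> _ [t t01 ->]; apply: (sep U2 U1) => // s s01.
  by have [|] := cov' _ s01; [right|left].
by move=> ? ?; apply: (disj' s).
Qed.

Lemma component_sub n (X : Rn n -> Prop) p q : component X p q -> X q.
Proof. by move=> [C [CX [_ [_ Cq]]]]; apply: CX. Qed.

Lemma component_trans n (X : Rn n -> Prop) p q r :
  component X p q -> component X q r -> component X p r.
Proof.
move=> [C [CX [Cc [Cp Cq]]]] [D [DX [Dc [Dq Dr]]]].
exists (fun z => C z \/ D z); split; first by move=> z [/CX|/DX].
by split; [exact: (connected_union Cq Dq)|split; [left|right]].
Qed.

Lemma component_sym n (X : Rn n -> Prop) p q :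
  component X p q -> component X q p.
Proof. by move=> [C [CX [Cc [Cp Cq]]]]; exists C. Qed.

Lemma vsubE n (x y : Rn n) : vsub x y = vadd x (vopp y).
Proof. by []. Qed.

Lemma vadd_subK n (x y : Rn n) : vsub (vadd x y) y = x.
Proof. by apply/funext => i; rewrite /vadd /vsub !RealsE addrK. Qed.

Lemma vsub_addK n (x y : Rn n) : vadd (vsub x y) y = x.
Proof. by apply/funext => i; rewrite /vadd /vsub !RealsE subrK. Qed.

(** * Translations of the graph and of its components *)

Section Graph.
Variables (d : nat) (f : Rn d -> R).
Hypothesis fD : additive f.

Lemma additive_vzero : f vzero = 0.
Proof.
have E : vadd vzero vzero = vzero :> Rn d.
  by apply/funext => i; rewrite /vadd /vzero !RealsE addr0.
by apply: (addIr (f vzero)); rewrite add0r; have := fD vzero vzero; rewrite E.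
Qed.

Lemma additive_vopp x : f (vopp x) = - f x.
Proof.
apply: (addIr (f x)); rewrite addNr -additive_vzero -[LHS]fD; congr f.
by apply/funext => i; rewrite /vadd /vopp !RealsE addNr.
Qed.

Lemma graph_vzero : graph f vzero.
Proof. exact/esym/additive_vzero. Qed.

Lemma graph_vadd p q : graph f p -> graph f q -> graph f (vadd p q).
Proof. by rewrite /graph => pE qE; rewrite [LHS]/vadd pE qE -fD. Qed.

Lemma graph_vopp p : graph f p -> graph f (vopp p).
Proof. by rewrite /graph => pE; rewrite [LHS]/vopp pE -[LHS]additive_vopp. Qed.

Lemma component_translate tau p q : graph f tau -> component (graph f) p q ->
  component (graph f) (vadd p tau) (vadd q tau).
Proof.
move=> ftau [C [CX [Cc [Cp Cq]]]]; exists (fun z => C (vsub z tau)).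
split; first by move=> z /CX fz; rewrite -(vsub_addK z tau); apply: graph_vadd.
by rewrite !vadd_subK; split; [exact: connected_translate|].
Qed.

(** Translation by [vopp p] carries the component of [p] to that of the origin; thus [tau = p]
    serves in (a). *)
Lemma component_vzeroE p q : graph f p ->
  component (graph f) p q <-> component (graph f) vzero (vsub q p).
Proof.
have add0 n (x : Rn n) : vadd vzero x = x.
  by apply/funext => i; rewrite /vadd /vzero !RealsE add0r.
move=> fp; split=> [pq|/(component_translate fp)].
  have := component_translate (graph_vopp fp) pq; rewrite -!vsubE.
  by rewrite (_ : vsub p p = vzero) //; apply/funext => i; rewrite /vsub !RealsE subrr.
by rewrite add0 vsub_addK.
Qed.

Lemma component_vzero_subgroup : is_subgroup (component (graph f) vzero).
Proof.
split; last split.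
- exists (fun q => q = vzero); split; first by move=> _ ->; exact: graph_vzero.
  split=> // U1 U2 _ _ cov _.
  by have [//|U10|U20] := cov vzero; [left|right] => _ ->.
- move=> x y x0 y0; have fx := component_sub x0.
  apply: component_trans x0 _; apply/(component_vzeroE _ fx).
  rewrite (_ : vsub _ _ = y) //; apply/funext => i.
  by rewrite /vadd /vsub !RealsE addrAC subrr add0r.
- move=> x x0; have fx := component_sub x0.
  have := (component_vzeroE vzero fx).1 (component_sym x0).
  rewrite (_ : vsub _ _ = vopp x) //; apply/funext => i.
  by rewrite /vopp /vsub /vzero !RealsE sub0r.
Qed.

End Graph.

Lemma subspace_has_dim n (V : Rn n -> Prop) : is_subspace V ->
  exists2 s, (s <= n)%N & has_dim V s.
Proof.
move=> [V0 [VD VZ]].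
have [||A AP] := @subspace_rowspace R n (fun v => V (v ord0)).
- by rewrite (_ : _ ord0 = vzero) //; apply/funext => i; rewrite mxE.
- move=> a u v Vu Vv.
  rewrite (_ : _ ord0 = vadd (vscale a (u ord0)) (v ord0)); first exact/VD/Vv/VZ.
  by apply/funext => i; rewrite !mxE.
have rowE (v : Rn n) : (\row_i v i) ord0 = v by apply/funext => i; rewrite mxE.
exists (\rank A); first exact: rank_leq_col.
have lincombE (c : 'I_(\rank A) -> R) :
    lincomb c (fun i j => row_base A i j) = ((\row_i c i) *m row_base A) ord0.
  by apply/funext => j; rewrite mxE; apply: eq_bigr => i _; congr (_ * _); rewrite mxE.
exists (fun i j => row_base A i j); split.
  move=> c; rewrite lincombE => c0 i.
  have : (\row_i c i) *m row_base A = 0.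
    by apply/rowP => j; rewrite [LHS](congr1 (fun v => v j) c0) mxE.
  move=> /eqP; rewrite mulmx_free_eq0 ?row_base_free // => /eqP/rowP/(_ i).
  by rewrite !mxE.
move=> v; rewrite -{1}[v]rowE AP -(eq_row_base A); split.
  move=> /submxP[D vE]; exists (D ord0); rewrite lincombE -[v]rowE vE.
  by congr ((_ *m _) _); apply/rowP => i; rewrite mxE.
move=> [c ->]; rewrite lincombE.
apply/submxP; exists (\row_i c i).
by apply/rowP => i; rewrite mxE.
Qed.

Theorem component_dense d (f : Rn d -> R) : additive f ->
  exists (s : nat) (V : Rn d.+1 -> Prop), (s <= d.+1)%N /\ is_subspace V /\
    has_dim V s /\ dense_subgroup_of (component (graph f) vzero) V.
Proof.
move=> fD; pose G := component (graph f) vzero.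
have [G0 [GD GN]] := component_vzero_subgroup fD.
have GB u v : G u -> G v -> G (vsub u v) by move=> Gu Gv; apply: GD => //; apply: GN.
have Gadh u : G u -> adherent G u.
  by move=> Gu e e0; exists u => // i; rewrite subrr normr0.
have adhD u v : adherent G u -> adherent G v -> adherent G (vadd u v).
  move=> Gu Gv e e0; have e2 : 0 < e / 2 by rewrite divr_gt0.
  have [[g Gg gu] [g' Gg' gv]] := (Gu _ e2, Gv _ e2).
  exists (vadd g g'); first exact: GD.
  move=> i; rewrite /vadd !RealsE opprD addrACA.
  apply: le_lt_trans (ler_normD _ _) _.
  by rewrite [ltRHS]splitr; apply: ltrD.
pose V (v : Rn d.+1) := forall t : R, adherent G (vscale t v).
have Vsub : is_subspace V.
  split; last split.
  - by move=> t; rewrite (_ : vscale _ _ = vzero); [exact: Gadh|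
      apply/funext => i; rewrite /vscale !RealsE mulr0].
  - move=> x y Vx Vy t.
    rewrite (_ : vscale _ _ = vadd (vscale t x) (vscale t y)); first exact: adhD.
    by apply/funext => i; rewrite /vscale /vadd !RealsE mulrDr.
  - move=> c x Vx t.
    rewrite (_ : vscale _ _ = vscale (t * c) x); first exact: Vx.
    by apply/funext => i; rewrite /vscale !RealsE mulrA.
have [s sd Vs] := subspace_has_dim Vsub.
exists s, V; split=> //; split=> //; split=> //; split; last split.
- exact: component_vzero_subgroup.
- have [e e0 eV] := adherent_subgroup_small G0 GB.
  have [_ [VD VZ]] := Vsub.
  have small x y : G x -> G y -> close e x y -> V (vsub x y).
    by move=> Gx Gy xy t; apply: eV => //; apply/Gadh/GB.
  have VN x : V x -> V (vopp x).
    by move=> /(VZ (-1)); congr V; apply/funext => i; rewrite /vscale /vopp !RealsE mulN1r.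
  move=> x [C [CX [Cc [C0 Cx]]]].
  have CG y : C y -> G y by move=> Cy; exists C.
  (* The [e]-neighbourhoods of the points of [C] inside [V] and of those outside [V] are open and
     cover [C]; by [small] they do not meet on [C]. *)
  pose U (W : Rn d.+1 -> Prop) (y : Rn d.+1) := exists z, [/\ C z, W z & close e z y].
  have Uo W : is_open (U W).
    apply/is_openP => y [z [Cz Wz zy]].
    pose m : R := e - \big[Num.max/0]_i `|z i - y i|.
    have m0 : 0 < m by rewrite subr_gt0; apply: bigmax_lt.
    exists m => // y' yy'; exists z; split=> // i.
    have zm : `|z i - y i| <= e - m.
      by rewrite /m subKr; apply: (le_bigmax _ (fun i => `|z i - y i|)).
    apply: le_lt_trans (ler_distD (y i) _ _) _.
    by rewrite -[e](subrK m); apply: ler_ltD.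
  have UV y : C y -> U V y -> V y.
    move=> Cy [z [Cz Vz zy]]; rewrite -(vsub_addK y z); apply: (VD) Vz.
    by apply: small; [exact: CG|exact: CG|move=> i; rewrite distrC].
  have UnV y : C y -> U (fun z => ~ V z) y -> ~ V y.
    move=> Cy [z [Cz Vz zy]] Vy; apply: Vz.
    by rewrite -(vsub_addK z y); apply: (VD) Vy; apply: small => //; exact: CG.
  have [||/(_ x Cx)|/(_ vzero C0)] := Cc _ _ (Uo V) (Uo (fun z => ~ V z)).
  - move=> y Cy; have yy : close e y y by move=> i; rewrite subrr normr0.
    by have [Vy|Vy] := pselect (V y); [left|right]; exists y.
  - by move=> y Cy /(UV _ Cy) Vy /(UnV _ Cy).
  - exact: UV.
  - by move=> /(UnV _ C0); case; exact: Vsub.1.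
- apply/dense_inP => v Vv; have := Vv 1.
  by congr adherent; apply/funext => i; rewrite /vscale !RealsE mul1r.
Qed.

End Euclidean.

(** * Examples for every dimension *)

Section JonesFunction.
Variable R : realType.
Local Open Scope ring_scope.

Lemma line_not_separated (P1 P2 : R -> Prop) a b :
  open_line P1 -> open_line P2 -> (forall x, P1 x \/ P2 x) ->
  (forall x, P1 x -> P2 x -> False) -> P1 a -> P1 b.
Proof.
move=> P1o P2o cov disj P1a; have [ab|/ltW ba] := leP a b.
  by apply: (segment_not_separated P1o P2o ab) => // x _; apply: disj.
have [//|P2b] := cov b; case: (disj a) => //.
apply: (segment_not_separated P2o P1o ba) => // x _; last by move=> ? /disj.
by have [] := cov x; [right|left].
Qed.

Lemma plane_open_or (U1 U2 : R -> R -> Prop) :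
  plane_open U1 -> plane_open U2 -> plane_open (fun x y => U1 x y \/ U2 x y).
Proof.
by move=> U1o U2o x y [/U1o|/U2o] [e e0 eU]; exists e => // x' y' xx' yy';
  [left|right]; apply: eU.
Qed.

Lemma plane_open_and (U1 U2 : R -> R -> Prop) :
  plane_open U1 -> plane_open U2 -> plane_open (fun x y => U1 x y /\ U2 x y).
Proof.
move=> U1o U2o x y [/U1o[e1 e10 eU1] /U2o[e2 e20 eU2]].
exists (Num.min e1 e2); first by rewrite lt_min e10.
by move=> x' y'; rewrite !lt_min => /andP[? ?] /andP[? ?]; split; [apply: eU1|apply: eU2].
Qed.

Lemma plane_open_vertical (U : R -> R -> Prop) x : plane_open U -> open_line (U x).
Proof.
by move=> Uo y /Uo[e e0 eU]; exists e => // y' yy'; apply: eU; rewrite // subrr normr0.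
Qed.

Lemma plane_open_proj (U : R -> R -> Prop) :
  plane_open U -> open_line (fun x => exists y, U x y).
Proof.
move=> Uo x [y /Uo[e e0 eU]]; exists e => // x' xx'; exists y.
by apply: eU; rewrite // subrr normr0.
Qed.

(* If U1 and U2 separated the graph, they would be disjoint by density; some
   vertical line meets both of them, hence so do the neighbouring ones, and the
   closed complement of U1 and U2 projects onto an interval without meeting the
   graph. *)
Lemma additive_dense_connected_graph : exists g : R -> R,
  [/\ {morph g : x y / x + y},
    forall x y e, 0 < e -> exists2 x', `|x - x'| < e & `|y - g x'| < e &
    forall U1 U2, plane_open U1 -> plane_open U2 ->
      (forall x, U1 x (g x) \/ U2 x (g x)) ->
      (forall x, U1 x (g x) -> U2 x (g x) -> False) ->
      (forall x, U1 x (g x)) \/ (forall x, U2 x (g x))].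
Proof.
have [g [gD gmeets]] := additive_graph_meets_closed R; exists g.
have gdense x y e : 0 < e -> exists2 x', `|x - x'| < e & `|y - g x'| < e.
  (* The complement of [U] is a horizontal segment at height [y], of half-width [e / 2] around
     [x]. *)
  move=> e0; pose U x' y' := e / 2 < `|x - x'| \/ y' != y.
  have [||x' /not_orP[xx' /negP]] := gmeets U.
  - move=> x' y' [xx'|yy'].
      exists (`|x - x'| - e / 2); first by rewrite subr_gt0.
      move=> x2 y2 x'x2 _; left.
      by have := ler_distD x2 x x'; rewrite (distrC x2); lra.
    exists `|y' - y|; first by rewrite normr_gt0 subr_eq0.
    move=> x2 y2 _ y'y2; right; apply: contraTneq y'y2 => ->.
    by rewrite ltxx.
  - exists (x - e / 2), (x + e / 2); split; first lra.
    move=> x' xx'; exists y => -[|]; last by rewrite eqxx.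
    by apply/negP; rewrite -leNgt ler_norml; lra.
  rewrite negbK => /eqP gx'; exists x'; last by rewrite gx' subrr normr0.
  by move/negP: xx'; rewrite -leNgt; lra.
split=> // U1 U2 U1o U2o cov disj.
have disjU x y : U1 x y -> U2 x y -> False.
  move=> U1xy U2xy; have [e e0 eU] := plane_open_and U1o U2o (conj U1xy U2xy).
  have [x' xx' yx'] := gdense x y e e0.
  by have [] := eU _ _ xx' yx'; apply: disj.
have [[a Ua]|/forallNP noU1] := pselect (exists a, U1 a (g a)); last first.
  by right=> x; have [/noU1|] := cov x.
left=> b; have [//|Ub] := cov b.
(* Otherwise the projections of [U1] and [U2] would be disjoint nonempty open sets covering the
   line. *)
have [x0 [[y1 U1y1] [y2 U2y2]]] :
    exists x0, (exists y, U1 x0 y) /\ (exists y, U2 x0 y).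
  apply: contrapT => /forallNP nox.
  have [y U1b] : exists y, U1 b y.
    apply: (@line_not_separated (fun x => exists y, U1 x y) (fun x => exists y, U2 x y) a b).
    - exact: plane_open_proj.
    - exact: plane_open_proj.
    - by move=> x; have [] := cov x; [left|right]; exists (g x).
    - by move=> x U1x U2x; apply: (nox x).
    - by exists (g a).
  by case: (nox b); split; [exists y|exists (g b)].
have [e1 e10 eU1] := U1o _ _ U1y1; have [e2 e20 eU2] := U2o _ _ U2y2.
have [||x []] := gmeets (fun x y => U1 x y \/ U2 x y); [|..|exact: cov].
- exact: plane_open_or.
- have e0 : 0 < Num.min e1 e2 by rewrite lt_min e10.
  exists (x0 - Num.min e1 e2), (x0 + Num.min e1 e2); split; first lra.
  move=> x xx0; apply: contrapT => /forallNP noy.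
  have : `|x0 - x| < Num.min e1 e2 by rewrite ltr_norml; lra.
  rewrite lt_min => /andP[xe1 xe2]; apply: (disjU x y2).
    apply: (@line_not_separated (U1 x) (U2 x) y1 y2).
    - exact: plane_open_vertical.
    - exact: plane_open_vertical.
    - by move=> y; apply: contrapT (noy y).
    - by move=> y; apply: disjU.
    - by apply: eU1; rewrite // subrr normr0.
  by apply: eU2; rewrite // subrr normr0.
Qed.

End JonesFunction.

(** * Components dense in coordinate subspaces *)

Section Examples.
Local Open Scope ring_scope.

Definition coordinate_subspace n s (v : Rn n) : Prop :=
  forall i : 'I_n, (s <= i)%N -> v i = 0.

Lemma coordinate_subspaceP n s : is_subspace (@coordinate_subspace n s).
Proof.
split; last split=> [x y Vx Vy|c x Vx]; move=> i si //.
  by rewrite /vadd Vx // Vy // !RealsE addr0.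
by rewrite /vscale Vx // !RealsE mulr0.
Qed.

Lemma coordinate_subspace_has_dim n s : (s <= n)%N ->
  has_dim (@coordinate_subspace n s) s.
Proof.
move=> sn; exists (fun (k : 'I_s) (j : 'I_n) => (k == j :> nat)%:R).
have lincombE (c : 'I_s -> R) (j : 'I_n) (k : 'I_s) : k = j :> nat ->
    lincomb c (fun (k : 'I_s) (j : 'I_n) => (k == j :> nat)%:R) j = c k.
  move=> kj; rewrite /lincomb (bigD1 k) //= big1; last first.
    move=> k' k'k; rewrite -kj -[_ == _]/(k' == k) (negPf k'k).
    by rewrite RealsE mulr0.
  by rewrite kj eqxx !RealsE mulr1 addr0.
split=> [c c0 k|v].
  by rewrite -(lincombE c (widen_ord sn k) k) // c0.
split=> [Vv|[c ->] j sj].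
  exists (fun k => v (widen_ord sn k)); apply/funext => j.
  have [js|sj] := ltnP j s.
    rewrite (lincombE _ j (Ordinal js)) //; congr v; exact: val_inj.
  rewrite Vv // /lincomb big1 // => k _.
  by rewrite (ltn_eqF (leq_trans (ltn_ord k) sj)) RealsE mulr0.
rewrite /lincomb big1 // => k _.
by rewrite (ltn_eqF (leq_trans (ltn_ord k) sj)) RealsE mulr0.
Qed.

Lemma component_coordinate_example d s : (s <= d)%N ->
  exists f : Rn d -> R, additive f /\
    dense_subgroup_of (component (graph f) vzero) (@coordinate_subspace d.+1 s).
Proof.
move=> sd; have [h [hD hinj [w w0 hw]]] := injective_additive_codim R d.
pose mask (x : Rn d) : 'rV[R]_d := \row_i (if (i < s)%N then 0 else x i).
have fD : additive (fun x => h (mask x)).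
  move=> x y; rewrite RealsE -hD; congr h; apply/rowP => i; rewrite !mxE.
  by case: ifP; rewrite ?addr0.
have h0 : h 0 = 0 by apply: (addIr (h 0)); rewrite -hD !add0r.
exists (fun x => h (mask x)); split=> //; split; last split.
- exact: component_vzero_subgroup.
- move=> q q0; have fq := component_sub q0.
  case: q0 => C [CX [Cc [C0 Cq]]].
  have qmax : q ord_max = 0.
    apply: contrapT => /eqP qmax.
    (* A nonzero rational multiple of [w] strictly between 0 and [q ord_max] is not a value of [h],
       so the hyperplane at that height would separate the origin from [q] within [C]. *)
    have [q' q'0 q'P] : exists2 q' : rat, q' != 0 &
        Num.min 0 (q ord_max) < ratr q' * w < Num.max 0 (q ord_max).
      apply: rat_multiple_in_itv => //.
      by rewrite gt_min !lt_max !ltxx /= orbF; case: ltgtP qmax.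
    pose c := ratr q' * w.
    have c0 : c != 0 by rewrite mulf_neq0 // fmorph_eq0.
    have nc p : C p -> p ord_max != c.
      move=> /CX fp; apply/eqP => pc; rewrite /graph pc in fp.
      by move/eqP: c0; apply; rewrite fp; apply: (hw _ q').
    have lo : is_open (fun p : Rn d.+1 => p ord_max < c).
      apply/is_openP => p pc; exists (c - p ord_max); first by rewrite subr_gt0.
      by move=> p' /(_ ord_max); rewrite ltr_norml => /andP[+ _]; lra.
    have hi : is_open (fun p : Rn d.+1 => c < p ord_max).
      apply/is_openP => p pc; exists (p ord_max - c); first by rewrite subr_gt0.
      by move=> p' /(_ ord_max); rewrite ltr_norml => /andP[_]; lra.
    move: q'P; rewrite -/c gt_min lt_max.
    have [||/[dup] /(_ _ C0) a0 /(_ _ Cq) aq|/[dup] /(_ _ C0) a0 /(_ _ Cq) aq] := Cc _ _ lo hi.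
    + by move=> p /nc; case: ltgtP; [left|right|].
    + by move=> p _ pc cp; have := lt_trans pc cp; rewrite ltxx.
    + by move=> /andP[_ /orP[ca|ca]];
        [have := lt_trans a0 ca|have := lt_trans aq ca]; rewrite ltxx.
    + by move=> /andP[/orP[ca|ca] _];
        [have := lt_trans a0 ca|have := lt_trans aq ca]; rewrite ltxx.
  (* As [h] vanishes only at 0, the coordinates that the mask keeps are 0. *)
  have : mask (fun i => q (widen_ord (leqnSn d) i)) = 0.
    by apply: hinj; rewrite -fq.
  move=> /rowP m0 i si; have [->//|id] := eqVneq i ord_max.
  have id' : (i < d)%N.
    by rewrite ltn_neqAle -ltnS ltn_ord andbT; apply: contra_neq id => ?; apply: val_inj.
  have := m0 (Ordinal id'); rewrite !mxE ltnNge si /= => <-.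
  by congr q; apply: val_inj.
(* On this subspace the masked vector and the last coordinate are 0, so the segment from the origin
   to [v] lies in the graph and [v] itself belongs to the component. *)
- apply/dense_inP => v Vv e e0; exists v; last by move=> i; rewrite subrr normr0.
  exists (fun q => exists2 t : R, 0 <= t <= 1 & q = fun i => vzero i + t * (v i - vzero i)).
  split.
    move=> _ [t _ ->]; rewrite /graph (Vv ord_max) // subrr mulr0 addr0.
    rewrite (_ : mask _ = 0) ?h0 //; apply/rowP => i; rewrite !mxE.
    case: ifPn => //; rewrite -leqNgt => si.
    by rewrite Vv // subrr mulr0 addr0.
  split; first exact: connected_segment.
  split.
    by exists 0; rewrite ?lexx ?ler01 //; apply/funext => i; rewrite mul0r addr0.
  exists 1; rewrite ?lexx ?ler01 //; apply/funext => i.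
  by rewrite mul1r /vzero addrC subrK.
Qed.

Lemma component_full_example d : (0 < d)%N ->
  exists f : Rn d -> R, additive f /\
    dense_subgroup_of (component (graph f) vzero) (@coordinate_subspace d.+1 d.+1).
Proof.
case: d => // d _; have [g [gD gdense gconn]] := additive_dense_connected_graph R.
exists (fun x => g (x ord0)).
have fD : additive (fun x : Rn d.+1 => g (x ord0)) by move=> x y; exact: gD.
have g0 : g 0 = 0 by apply: (addIr (g 0)); rewrite -gD !add0r.
(* The plane is embedded in the first and last coordinates, which are distinct because the dimension
   is at least 2. *)
pose psi x y : Rn d.+2 := fun i => if i == ord_max then y else if i == ord0 then x else 0.
have w0 : widen_ord (leqnSn d.+1) ord0 = ord0 :> 'I_d.+2 by apply: val_inj.
have graphE q : graph (fun x : Rn d.+1 => g (x ord0)) q <-> q ord_max = g (q ord0).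
  by rewrite /graph w0.
have psi_conn : connected (fun q => exists x, q = psi x (g x)).
  move=> U1 U2 /is_openP U1o /is_openP U2o cov disj.
  have pre (U : Rn d.+2 -> Prop) :
      (forall x, U x -> exists2 e, 0 < e & forall y, close e x y -> U y) ->
      plane_open (fun x y => U (psi x y)).
    move=> Uo x y /Uo[e e0 eU]; exists e => // x' y' xx' yy'; apply: eU => i.
    by rewrite /psi; do 2?case: ifP => // _; rewrite subrr normr0.
  have [||h|h] := gconn _ _ (pre _ U1o) (pre _ U2o).
  - by move=> x; apply: cov; exists x.
  - by move=> x; apply: disj; exists x.
  - by left=> _ [x ->]; apply: h.
  - by right=> _ [x ->]; apply: h.
(* The origin is joined to [q] in two moves: through the embedded planar graph to the point with the
   same first and last coordinates as [q], then along a segment on which these two stay fixed. *)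
have whole q : q ord_max = g (q ord0) ->
    component (graph (fun x : Rn d.+1 => g (x ord0))) vzero q.
  move=> fq; apply: (@component_trans _ _ _ (psi (q ord0) (g (q ord0)))).
    exists (fun q => exists x, q = psi x (g x)); split.
      by move=> _ [x ->]; apply/graphE; rewrite /psi eqxx.
    split=> //; split; last by exists (q ord0).
    by exists 0; apply/funext => i; rewrite /psi g0 !if_same.
  set p := psi _ _.
  exists (fun z => exists2 t : R, 0 <= t <= 1 & z = fun i => p i + t * (q i - p i)).
  split.
    move=> _ [t _ ->]; apply/graphE.
    by rewrite /p /psi eqxx /= fq !subrr !mulr0 !addr0.
  split; first exact: connected_segment.
  split.
    by exists 0; rewrite ?lexx ?ler01 //; apply/funext => i; rewrite mul0r addr0.
  exists 1; rewrite ?lexx ?ler01 //; apply/funext => i.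
  by rewrite mul1r addrC subrK.
split=> //; split; first exact: component_vzero_subgroup.
split; first by move=> x _ i; rewrite leqNgt ltn_ord.
apply/dense_inP => v _ e e0.
have [x xe ye] := gdense (v ord0) (v ord_max) e e0.
(* Density of the planar graph supplies the first and last coordinates; the others are unconstrained
   and are copied from [v]. *)
exists (fun i => if i == ord_max then g x else if i == ord0 then x else v i).
  by apply: whole; rewrite eqxx.
move=> i; rewrite distrC; case: eqP => [->//|_]; case: eqP => [->//|_].
by rewrite subrr normr0.
Qed.

End Examples.

Theorem theorem3 (d : nat) (hd : (0 < d)%N) :
  (forall f : Rn d -> R, additive f ->
     exists (s : nat) (V : Rn d.+1 -> Prop),
       (s <= d.+1)%N /\ is_subspace V /\ has_dim V s /\
       dense_subgroup_of (component (graph f) vzero) V /\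
       (forall p, graph f p ->
          exists tau : Rn d.+1, forall q,
            component (graph f) p q <-> component (graph f) vzero (vsub q tau)))
  /\
  (forall s : nat, (s <= d.+1)%N ->
     exists f : Rn d -> R, additive f /\
       exists V : Rn d.+1 -> Prop,
         is_subspace V /\ has_dim V s /\
         dense_subgroup_of (component (graph f) vzero) V).
Proof.
split=> [f fD|s sd].
  have [s [V [sd [Vsub [Vdim Vdense]]]]] := component_dense fD.
  exists s, V; do 4!split=> //; move=> p fp; exists p => q.
  exact: component_vzeroE.
have [f [fD fV]] : exists f : Rn d -> R, additive f /\
    dense_subgroup_of (component (graph f) vzero) (@coordinate_subspace d.+1 s).
  move: sd; rewrite leq_eqVlt => /predU1P[->|]; first exact: component_full_example.
  by rewrite ltnS; exact: component_coordinate_example.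
exists f; split=> //; exists (@coordinate_subspace d.+1 s).
by split; [exact: coordinate_subspaceP|split; [exact: coordinate_subspace_has_dim|]].
Qed.
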